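(* Let $u\geq 4$ be an integer, let $\mathcal{D}$ be a Menon $2$-design with parameters $(4u^2,2u^2-u,u^2-u)$, and let $\Gamma(\mathcal{D})$ be its incidence graph, which has $n=8u^2$ vertices. Let $B_{n,p}$ be the $n$-vertex bipartite chain graph defined in the context, where $p=\frac{n}{3}$ if $3\mid u$, and $p=\frac{n}{3}+\frac{1}{3}$ otherwise. Then $$\sigma(\Gamma(\mathcal{D}),B_{n,p})>\sigma(K_{\frac{n}{2},\frac{n}{2}},\Gamma(\mathcal{D})).$$
   Context: All graphs are finite, simple and undirected. For a graph $G$ on $n$ vertices, $\lambda_1(G)\geq\cdots\geq\lambda_n(G)$ denote the eigenvalues of its adjacency matrix, with multiplicity, in non-increasing order. The spectral distance between two graphs $G,H$ on $n$ vertices is $\sigma(G,H)=\sum_{i=1}^{n}|\lambda_i(G)-\lambda_i(H)|$. $K_{p,q}$ is the complete bipartite graph with parts of sizes $p$ and $q$. A Menon $2$-design with parameters $(4u^2,2u^2-u,u^2-u)$ is a symmetric design with these parameters $(v,k,\lambda^* )$: it consists of a set of $v=4u^2$ points and $v=4u^2$ blocks (subsets of the point set) such that every block contains exactly $k=2u^2-u$ points, every point lies in exactly $k=2u^2-u$ blocks, and any two distinct points lie together in exactly $\lambda^*=u^2-u$ blocks. The incidence graph $\Gamma(\mathcal{D})$ of a design $\mathcal{D}$ is the bipartite graph whose vertices are the points and the blocks, a point and a block being adjacent if and only if the point belongs to the block (and no other adjacencies). For even $n$ and an integer $1\leq p<\frac{n}{2}$, $B_{n,p}$ is the connected bipartite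 graph of order $n$ with bipartition $X=\{x_1,\ldots,x_{n/2}\}$, $Y=\{y_1,\ldots,y_{n/2}\}$, in which $x_i$ with $i\leq p$ is adjacent to all of $y_1,\ldots,y_{n/2}$, and $x_i$ with $i>p$ is adjacent exactly to $y_1,\ldots,y_p$. *)

(* Defs.v *)
From mathcomp Require Import all_boot all_order all_algebra.
From mathcomp Require Import spectral polyrcf complex.

Set Implicit Arguments.
Unset Strict Implicit.
Unset Printing Implicit Defensive.

Import Order.TTheory GRing.Theory Num.Theory.
Local Open Scope ring_scope.

Record sgraph := SGraph {
  vertex :> finType;
  adj : rel vertex;
  adj_sym : symmetric adj;
  adj_irrefl : irreflexive adj }.

Definition adjmx (R : nzRingType) (G : sgraph) : 'M[R]_#|G| :=
  \matrix_(i, j) (adj (enum_val i) (enum_val j))%:R.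

(* The eigenvalues of A lying in R, with algebraic multiplicity, in
   non-increasing order. For a symmetric A these are all the eigenvalues:
   see [char_poly_spectrum] and [size_spectrum]. *)
Definition spectrum (R : rcfType) (n : nat) (A : 'M[R]_n) : seq R :=
  let f := char_poly A in
  sort >=%R (flatten [seq nseq (mup x f) x | x <- rootsR f]).

(* Indexed from 0, so that the usual lambda_1 is [eigval R G 0]. *)
Definition eigval (R : rcfType) (G : sgraph) (i : nat) : R :=
  (spectrum (adjmx R G))`_i.

(* Meaningful for graphs of the same order only. *)
Definition spectral_dist (R : rcfType) (G H : sgraph) : R :=
  \sum_(i < #|G|) `|eigval R G i - eigval R H i|.

Section Bipartite.
Variables (X Y : finType) (e : X -> Y -> bool).

Definition bipartite_adj : rel (X + Y)%type := fun a b =>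
  match a, b with
  | inl x, inr y | inr y, inl x => e x y
  | _, _ => false
  end.

Fact bipartite_adj_sym : symmetric bipartite_adj.
Proof. by case=> [x|y] []. Qed.

Fact bipartite_adj_irrefl : irreflexive bipartite_adj.
Proof. by case. Qed.

Definition bipartite_graph : sgraph :=
  SGraph bipartite_adj_sym bipartite_adj_irrefl.
End Bipartite.

Definition complete_bipartite (p q : nat) : sgraph :=
  bipartite_graph (fun (_ : 'I_p) (_ : 'I_q) => true).

(* B_{n,p} for even n and 1 <= p < n/2, with the indices of the x_i and y_j
   shifted to start from 0. *)
Definition chain_graph (n p : nat) : sgraph :=
  bipartite_graph (fun i j : 'I_n./2 => (i < p)%N || (j < p)%N).

Record symmetric_design (P : finType) (v k l : nat) := SymmetricDesign {
  blocks :> {set {set P}};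
  card_points : #|P| = v;
  card_blocks : #|blocks| = v;
  block_size : forall B, B \in blocks -> #|B| = k;
  point_degree : forall x : P, #|[set B in blocks | x \in B]| = k;
  pair_degree : forall x y : P, x != y ->
    #|[set B in blocks | (x \in B) && (y \in B)]| = l }.

Definition menon_design (P : finType) (u : nat) :=
  symmetric_design P (4 * u ^ 2)%N (2 * u ^ 2 - u)%N (u ^ 2 - u)%N.

Definition incidence_graph (P : finType) (D : {set {set P}}) : sgraph :=
  bipartite_graph (fun (x : P) (B : {B : {set P} | B \in D}) => x \in val B).

Lemma adjmx_sym (R : nzRingType) (G : sgraph) : (adjmx R G)^T = adjmx R G.
Proof. by apply/matrixP=> i j; rewrite !mxE adj_sym. Qed.

Lemma spectrum_eq (R : rcfType) (n : nat) (A : 'M[R]_n) (s : seq R) :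
  char_poly A = \prod_(x <- s) ('X - x%:P) -> spectrum A = sort >=%R s.
Proof.
move=> As; rewrite /spectrum; set f := char_poly A in As *.
have f0 : f != 0 by rewrite monic_neq0 ?char_poly_monic.
apply/perm_sortP; [exact: ge_total|exact: ge_trans|exact: ge_anti|].
apply: perm_trans (perm_count_undup s).
have -> : [seq nseq (count_mem x s) x | x <- undup s] =
          [seq nseq (mup x f) x | x <- undup s].
  by apply: eq_map => x; rewrite As mu_prod_XsubC.
apply/perm_flatten/perm_map/uniq_perm; rewrite ?undup_uniq ?uniq_roots //.
by move=> x; rewrite mem_undup -roots_on_rootsR // As root_prod_XsubC.
Qed.

Lemma char_poly_sym_split (R : rcfType) (n : nat) (A : 'M[R]_n) :
  A^T = A -> exists s, char_poly A = \prod_(x <- s) ('X - x%:P).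
Proof.
move=> As; pose C := map_mx (real_complex R) A.
have Ch : C \is hermsymmx.
  apply: realsym_hermsym; first by rewrite is_hermitianmxE expr0 scale1r map_mx_id // map_trmx As.
  by apply/mxOverP => i j; rewrite mxE; apply/complex_realP; exists (A i j).
pose d := spectral_diag C; pose Q := spectralmx C.
have Qu : Q \in unitmx by exact: spectral_unit.
have CE : C = invmx Q *m diag_mx d *m Q.
  exact/orthomx_spectralP/hermitian_normalmx.
exists [seq complex.Re (d 0 i) | i <- enum 'I_n].
apply: (map_poly_inj (real_complex R)).
rewrite map_char_poly -/C rmorph_prod big_map big_enum /=.
have -> : char_poly C = char_poly (diag_mx d).
  rewrite /char_poly /char_poly_mx CE.
  pose q := map_mx (@polyC _) Q; pose q' := map_mx (@polyC _) (invmx Q).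
  have q'q : q' *m q = 1%:M by rewrite -map_mxM mulVmx // map_mx1.
  have -> : 'X%:M - map_mx (@polyC _) (invmx Q *m diag_mx d *m Q) =
            q' *m ('X%:M - map_mx (@polyC _) (diag_mx d)) *m q.
    by rewrite mulmxBr mulmxBl !map_mxM -[q' *m _%:M *m q]mulmxA -scalar_mxC mulmxA q'q mul1mx.
  by rewrite !det_mulmx mulrAC -det_mulmx q'q det1 mul1r.
rewrite char_poly_trig ?diag_mx_is_trig //; apply: eq_bigr => i _.
rewrite rmorphB /= map_polyX map_polyC /= mxE eqxx mulr1n RRe_real //.
by have /mxOverP := hermitian_spectral_diag_real Ch; apply.
Qed.

Lemma char_poly_spectrum (R : rcfType) (n : nat) (A : 'M[R]_n) :
  A^T = A -> char_poly A = \prod_(x <- spectrum A) ('X - x%:P).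
Proof.
move=> /char_poly_sym_split[s As]; rewrite (spectrum_eq As) As.
by apply: perm_big; rewrite perm_sym perm_sort.
Qed.

Lemma size_spectrum (R : rcfType) (n : nat) (A : 'M[R]_n) :
  A^T = A -> size (spectrum A) = n.
Proof.
move=> /char_poly_spectrum /(congr1 (fun f : {poly R} => size f)).
by rewrite size_char_poly size_prod_XsubC => -[].
Qed.

(* Main.v *)
Require Import Defs.
From mathcomp Require Import all_boot all_order all_algebra.
From mathcomp Require Import zify ring lra.

Set Implicit Arguments.
Unset Strict Implicit.
Unset Printing Implicit Defensive.

Import Order.TTheory GRing.Theory Num.Theory.
Local Open Scope ring_scope.

(** The three graphs are bipartite with parts of the same size m = 4 u^2, so
    the spectrum of each consists of the singular values of its biadjacency
    matrix N and their opposites ([bipartite_spectrum]), and the distance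
    between two of them is twice the l1 distance between the decreasing
    sequences of singular values ([spectral_dist_symmetric]). The squares of
    the singular values are the eigenvalues of N N^T, whose entries count
    common neighbours. Write k = 2 u^2 - u.

    - For K_{m,m}, N N^T is constant, and the singular values are m and 0
      (m - 1 times).
    - For the design, N N^T is u^2 on the diagonal plus the constant u^2 - u,
      and the singular values are k and u (m - 1 times).
    - For B_{n,p}, N N^T has rank 2, and the singular values are
      (w + p) / 2, (w - p) / 2 and 0 (m - 2 times), where
      w^2 = p (4 m - 3 p).

    The contributions of the last m - 2 singular values agree on both sides,
    so what has to be shown is
    |k - (w + p) / 2| + |u - (w - p) / 2| > (m - k) + u,
    and, the left-hand side being at least w - k - u, it is enough that
    w > m + 2 u = 4 u^2 + 2 u. The function p (4 m - 3 p) is maximal at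
    p = 2 m / 3 = n / 3; the given p is within 1 / 3 of it, so that w is about
    2 m / sqrt 3, that is 4.618 u^2, which exceeds 4 u^2 + 2 u as soon as u >= 4.

    All characteristic polynomials come from the Schur complements of a block
    matrix with scalar diagonal blocks: these give both the reduction of the
    adjacency matrix to N N^T and the elimination of low-rank terms
    ([char_poly_scalar_addM]). *)

(** * Determinants of block matrices with scalar diagonal blocks *)

Section BlockDeterminants.
Variable R : comNzRingType.

(** The powers of [a] make up for the missing inverse of [a]: eliminating [C]
    takes the row operation that multiplies the lower rows by [a] and subtracts
    [C] times the upper ones. *)
Lemma det_block_schur_dr (m r : nat) (a d : R) (B : 'M[R]_(m, r))
    (C : 'M[R]_(r, m)) :
  a ^+ r * \det (block_mx a%:M B C d%:M) =
  a ^+ m * \det ((a * d)%:M - C *m B).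
Proof.
rewrite -[a ^+ r]mul1r -(det1 R m) -(det_scalar r a) -(det_lblock _ (- C)).
rewrite -det_mulmx mulmx_block !mul1mx !mul0mx !addr0 mul_mx_scalar.
rewrite !mul_scalar_mx scalerN addNr.
by rewrite det_ublock det_scalar mulNmx addrC scale_scalar_mx.
Qed.

Lemma det_block_schur_ul (m r : nat) (a d : R) (B : 'M[R]_(m, r))
    (C : 'M[R]_(r, m)) :
  d ^+ m * \det (block_mx a%:M B C d%:M) =
  d ^+ r * \det ((a * d)%:M - B *m C).
Proof.
rewrite -[d ^+ m]mulr1 -(det1 R r) -(det_scalar m d) -(det_ublock _ (- B)).
rewrite -det_mulmx mulmx_block !mul1mx !mul0mx !add0r !mul_scalar_mx.
rewrite mul_mx_scalar scalerN subrr.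
by rewrite det_lblock det_scalar mulrC mulNmx scale_scalar_mx [a * d]mulrC.
Qed.

(** Sylvester's identity: both sides are the determinant of the block matrix
    with rows [t, U] and [V, 1], computed by its two Schur complements. *)
Lemma det_scalar_subM (m r : nat) (t : R) (U : 'M[R]_(m, r))
    (V : 'M[R]_(r, m)) :
  t ^+ r * \det (t%:M - U *m V) = t ^+ m * \det (t%:M - V *m U).
Proof.
have := det_block_schur_dr t 1 U V; have := det_block_schur_ul t 1 U V.
by rewrite !expr1n !mul1r mulr1 => <-.
Qed.

End BlockDeterminants.

(** * Characteristic polynomials *)

Section CharPoly.
Variable R : idomainType.

Lemma char_poly_comp_poly (n : nat) (A : 'M[R]_n) (q : {poly R}) :
  char_poly A \Po q = \det (q%:M - map_mx (@polyC R) A).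
Proof.
rewrite /char_poly -[_ \Po _]/(comp_poly q _) -det_map_mx; congr (\det _).
by apply/matrixP=> i j; rewrite !mxE rmorphB /= raddfMn /= comp_polyX comp_polyC.
Qed.

(** A perturbation of a scalar matrix by a matrix of rank at most [r] is
    governed by an [r] by [r] matrix. *)
Lemma char_poly_scalar_addM (m r : nat) (c : R) (U : 'M[R]_(m, r))
    (V : 'M[R]_(r, m)) :
  ('X - c%:P) ^+ r * char_poly (c%:M + U *m V) =
  ('X - c%:P) ^+ m * (char_poly (V *m U) \Po ('X - c%:P)).
Proof.
rewrite char_poly_comp_poly /char_poly /char_poly_mx map_mxD map_scalar_mx /=.
rewrite opprD addrA -raddfB /= !map_mxM; exact: det_scalar_subM.
Qed.

(** The two matrices may have formally different sizes, so they are related by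
    [A = U M U^T] with [U] the rectangular 0-1 matrix of the bijection, and
    [char_poly_scalar_addM] replaces the usual conjugation argument. *)
Lemma char_poly_reindex (T : finType) (F : T -> T -> R) (m : nat)
    (f : 'I_m -> T) : bijective f ->
  char_poly (\matrix_(i, j < #|T|) F (enum_val i) (enum_val j)) =
  char_poly (\matrix_(i, j < m) F (f i) (f j)).
Proof.
move=> f_bij; have mT : #|T| = m by rewrite -(bij_eq_card f_bij) card_ord.
pose U : 'M[R]_(#|T|, m) := \matrix_(i, j) (enum_val i == f j)%:R.
set A := (X in char_poly X = _); set M := (X in _ = char_poly X).
have [f' fK f'K] := f_bij.
have UU : U^T *m U = 1%:M.
  apply/matrixP=> i j; rewrite !mxE (bigD1 (enum_rank (f i))) //= !mxE.
  rewrite enum_rankK eqxx mul1r (inj_eq (bij_inj f_bij)) big1 ?addr0 // => k ki.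
  rewrite !mxE [_ == f i]negbTE ?mul0r //.
  by apply: contra ki => /eqP <-; rewrite enum_valK.
have -> : A = 0%:M + U *m (M *m U^T).
  rewrite raddf0 add0r; apply/matrixP=> i j; rewrite !mxE.
  rewrite (bigD1 (f' (enum_val i))) //= big1 ?addr0 => [|k ki]; last first.
    rewrite !mxE [_ == f k]negbTE ?mul0r //.
    by apply: contra ki => /eqP ->; rewrite fK.
  rewrite !mxE f'K eqxx mul1r (bigD1 (f' (enum_val j))) //= big1 ?addr0.
    by rewrite !mxE !f'K eqxx mulr1.
  move=> k kj; rewrite !mxE [_ == f k]negbTE ?mulr0 //.
  by apply: contra kj => /eqP ->; rewrite fK.
have X0 : ('X - 0%:P : {poly R}) ^+ m != 0 by rewrite expf_neq0 ?polyXsubC_eq0.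
apply: (mulfI X0); rewrite char_poly_scalar_addM -mulmxA UU mulmx1.
by rewrite mT polyC0 subr0 comp_polyXr.
Qed.

Lemma char_poly_scalar_add_const (m : nat) (c l : R) :
  char_poly (c%:M + const_mx l : 'M_m.+1) =
  ('X - (c + l *+ m.+1)%:P) * ('X - c%:P) ^+ m.
Proof.
have X0 : 'X - c%:P != 0 by rewrite polyXsubC_eq0.
have -> : const_mx l = (const_mx 1 : 'cV_m.+1) *m const_mx l :> 'M_m.+1.
  apply/matrixP=> i j; rewrite !mxE big_ord1 !mxE mul1r //.
apply: (mulfI X0); have := char_poly_scalar_addM c (const_mx 1 : 'cV_m.+1) (const_mx l).
rewrite expr1 => ->; rewrite char_poly_comp_poly det_mx11 !mxE eqxx.
under eq_bigr do rewrite !mxE mulr1.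
by rewrite sumr_const card_ord polyCD exprS mulr1n opprD addrA -mulrA [_ ^+ m * _]mulrC.
Qed.

End CharPoly.

Lemma char_poly_block11 (R : idomainType) (a b c d : R) :
  char_poly (block_mx a%:M b%:M c%:M d%:M : 'M_(1 + 1)) =
  ('X - a%:P) * ('X - d%:P) - (b * c)%:P.
Proof.
have X0 : 'X - a%:P != 0 by rewrite polyXsubC_eq0.
apply: (mulfI X0); rewrite -{1}['X - _]expr1.
rewrite /char_poly /char_poly_mx map_block_mx !map_scalar_mx /=.
rewrite (scalar_mx_block 1 1) opp_block_mx add_block_mx !add0r -!raddfB /=.
rewrite det_block_schur_dr expr1 mulNmx mulmxN opprK -scalar_mxM -raddfB.
by rewrite det_scalar1 polyCM [c%:P * _]mulrC.
Qed.

(** * Spectra and distances of balanced bipartite graphs *)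

Section BipartiteSpectrum.
Variables (X Y : finType) (e : X -> Y -> bool).

Definition common_nbrs (x x' : X) : nat := #|[set y | e x y && e x' y]|.

(** With [N] the biadjacency matrix, the Schur complement of 'X in
    'X - [0, N; N^T, 0] gives the determinant of 'X^2 - N N^T; the powers of 'X
    cancel because the two parts have the same size. *)
Lemma bipartite_char_poly (R : idomainType) (m : nat) (f : 'I_m -> X) :
  bijective f -> #|Y| = m ->
  char_poly (adjmx R (bipartite_graph e)) =
  char_poly (\matrix_(i, j) (common_nbrs (f i) (f j))%:R) \Po 'X^2.
Proof.
move=> f_bij Ym.
pose g (j : 'I_m) : Y := enum_val (cast_ord (esym Ym) j).
have g_bij : bijective g.
  by apply: inj_card_bij; rewrite ?card_ord ?Ym // => i j /enum_val_inj/cast_ord_inj.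
pose h (i : 'I_(m + m)) : X + Y :=
  match split i with inl i => inl (f i) | inr j => inr (g j) end.
have h_bij : bijective h.
  apply: inj_card_bij; last first.
    by rewrite card_ord card_sum -(bij_eq_card f_bij) Ym card_ord.
  move=> i j; rewrite /h -{2}[i]splitK -{2}[j]splitK.
  case: (split i) (split j) => [i'|i'] [j'|j'] //= [].
    by move=> /(bij_inj f_bij) ->.
  by move=> /(bij_inj g_bij) ->.
pose N : 'M[R]_m := \matrix_(i, j) (e (f i) (g j))%:R.
have -> : char_poly (adjmx R (bipartite_graph e)) =
          char_poly (block_mx 0 N N^T 0).
  rewrite (char_poly_reindex (fun a b => (bipartite_adj e a b)%:R) h_bij).
  congr char_poly; apply/matrixP=> i j; rewrite !mxE /h.
  by case: (split i) => i'; rewrite !mxE; case: (split j) => j'; rewrite !mxE.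
have -> : \matrix_(i, j) (common_nbrs (f i) (f j))%:R = N *m N^T.
  apply/matrixP=> i j; rewrite !mxE.
  under eq_bigr do rewrite !mxE -natrM mulnb.
  rewrite /common_nbrs -sum1dep_card big_mkcond /= natr_sum.
  by rewrite (reindex g) /=; [apply: eq_bigr => k _; case: ifP|exact: onW_bij].
rewrite char_poly_comp_poly map_mxM /= expr2.
have X0 : ('X : {poly R}) ^+ m != 0 by rewrite expf_neq0 ?polyX_eq0.
apply: (mulfI X0); rewrite /char_poly /char_poly_mx map_block_mx !raddf0.
rewrite (scalar_mx_block m m) opp_block_mx add_block_mx !add0r oppr0 !addr0.
by rewrite det_block_schur_ul mulNmx mulmxN opprK.
Qed.

Lemma bipartite_spectrum (R : rcfType) (m : nat) (f : 'I_m -> X) (s : seq R) :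
  bijective f -> #|Y| = m -> sorted >=%R s -> all (>= 0) s ->
  char_poly (\matrix_(i, j) (common_nbrs (f i) (f j))%:R) =
    \prod_(x <- s) ('X - (x ^+ 2)%:P) ->
  spectrum (adjmx R (bipartite_graph e)) = s ++ rev [seq - x | x <- s].
Proof.
move=> f_bij Ym s_sorted s_ge0 Gs.
rewrite (@spectrum_eq _ _ _ (s ++ rev [seq - x | x <- s])); last first.
  rewrite (bipartite_char_poly _ f_bij Ym) Gs rmorph_prod big_cat /=.
  rewrite (perm_big _ (permEl (perm_rev [seq - x | x <- s]))) big_map -big_split /=.
  apply: eq_bigr => x _; rewrite comp_polyB comp_polyX comp_polyC.
  by rewrite polyCN rmorphXn /=; ring.
apply: sorted_sort; first exact: ge_trans.
have ge_tr : transitive (>=%R : rel R) by exact: ge_trans.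
rewrite !(sorted_pairwise ge_tr) pairwise_cat -!(sorted_pairwise ge_tr).
rewrite s_sorted rev_sorted sorted_map /=; apply/andP; split.
  apply/allrelP=> x y xs; rewrite mem_rev => /mapP[z zs ->].
  by apply: le_trans (allP s_ge0 x xs); rewrite oppr_le0 (allP s_ge0).
by apply: sub_sorted s_sorted => x y /=; rewrite lerN2.
Qed.

End BipartiteSpectrum.

Lemma spectral_dist_symmetric (R : rcfType) (G H : sgraph) (m : nat)
    (s t : seq R) :
  #|G| = (m + m)%N -> size s = m -> size t = m ->
  spectrum (adjmx R G) = s ++ rev [seq - x | x <- s] ->
  spectrum (adjmx R H) = t ++ rev [seq - x | x <- t] ->
  spectral_dist R G H = (\sum_(i < m) `|s`_i - t`_i|) *+ 2.
Proof.
move=> Gm sm tm Gs Ht; rewrite /spectral_dist /eigval Gs Ht Gm.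
rewrite big_split_ord mulr2n /=; congr (_ + _).
  by apply: eq_bigr => i _; rewrite !nth_cat sm tm ltn_ord.
rewrite (reindex_inj rev_ord_inj); apply: eq_bigr => i _.
have im := ltn_ord i.
rewrite !nth_cat sm tm /= ltnNge leq_addr /= addKn.
rewrite !nth_rev ?size_map ?sm ?tm; try lia.
rewrite -subSn // subSS subKn; last exact: ltnW.
by rewrite !(nth_map 0) ?sm ?tm // distrC opprK addrC.
Qed.

(** * Singular values of the three graphs *)

Section SingularValues.
Variable R : rcfType.

Lemma path_ge_nseq (m : nat) (x y : R) : y <= x -> path >=%R x (nseq m y).
Proof. by elim: m x => //= m IHm x ->; rewrite IHm. Qed.

Lemma complete_bipartite_spectrum (m : nat) :
  let s := m.+1%:R :: nseq m 0 in
  spectrum (adjmx R (complete_bipartite m.+1 m.+1)) =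
    s ++ rev [seq - x | x <- s].
Proof.
apply: (@bipartite_spectrum _ _ _ _ m.+1 id).
- by exists id.
- exact: card_ord.
- exact: path_ge_nseq.
- by rewrite /= ler0n all_nseq lexx orbT.
have -> : \matrix_(i < m.+1, j < m.+1)
     (common_nbrs (fun _ _ : 'I_m.+1 => true) i j)%:R =
     0%:M + const_mx m.+1%:R :> 'M[R]_m.+1.
  apply/matrixP=> i j; rewrite !mxE mul0rn add0r; congr (_%:R).
  by rewrite /common_nbrs -[RHS]card_ord -cardsT; apply: eq_card => y; rewrite !inE.
rewrite char_poly_scalar_add_const big_cons big_nseq expr0n add0r.
by rewrite iter_mulr_1 expr2 mulr_natr.
Qed.

Lemma symmetric_design_common_nbrs (P : finType) (v k l : nat)
    (D : symmetric_design P v k l) (x y : P) :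
  common_nbrs (fun (x : P) (B : {B : {set P} | B \in blocks D}) => x \in val B)
    x y = if x == y then k else l.
Proof.
have -> : common_nbrs (fun (x : P) (B : {B : {set P} | B \in blocks D}) =>
    x \in val B) x y = #|[set B in blocks D | (x \in B) && (y \in B)]|.
  rewrite /common_nbrs -(card_imset _ val_inj); apply: eq_card => B.
  rewrite !inE; apply/imsetP/andP => [[C] | [BD xyB]].
    by rewrite inE => xyC ->; split=> //; exact: valP.
  by exists (Sub B BD); rewrite ?inE ?SubK.
have [<-|xy] := eqVneq x y; last exact: pair_degree xy.
rewrite -[RHS](point_degree D x); apply: eq_card => B.
by rewrite !inE andbb.
Qed.

(** Here [k ^ 2] is the eigenvalue [u ^ 2 + l * v] of N N^T on the constant
    vectors, and [u ^ 2 = k - l] is its eigenvalue on their complement. *)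
Lemma incidence_graph_spectrum (P : finType) (v k l u : nat)
    (D : symmetric_design P v k l) :
  (0 < v)%N -> (u <= k)%N -> (k = l + u ^ 2)%N ->
  (k ^ 2 = u ^ 2 + l * v)%N ->
  let s := k%:R :: nseq v.-1 u%:R in
  spectrum (adjmx R (incidence_graph D)) = s ++ rev [seq - x | x <- s].
Proof.
case: v D => // m D _ uk kl kk s.
have Pm := card_points D.
apply: (@bipartite_spectrum _ _ _ _ m.+1 (enum_val \o cast_ord (esym Pm))).
- apply: inj_card_bij; last by rewrite card_ord Pm.
  by move=> i j /= /enum_val_inj/cast_ord_inj.
- by rewrite card_sig; exact: card_blocks D.
- by apply: path_ge_nseq; rewrite ler_nat.
- by rewrite /= ler0n all_nseq ler0n orbT.
rewrite (_ : \matrix_(i, j) _ = (u%:R ^+ 2)%:M + const_mx l%:R); last first.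
  apply/matrixP=> i j; rewrite !mxE symmetric_design_common_nbrs /=.
  rewrite (inj_eq enum_val_inj) (inj_eq (@cast_ord_inj _ _ _)).
  by case: (i == j); rewrite ?add0r // kl natrD natrX addrC.
rewrite char_poly_scalar_add_const big_cons big_nseq iter_mulr_1.
by rewrite -[k%:R ^+ 2]natrX kk natrD natrX natrM mulr_natr.
Qed.

Lemma card_ord_ltn (m p : nat) : (p <= m)%N ->
  #|[set i : 'I_m | (i < p)%N]| = p.
Proof.
move=> pm; transitivity #|[set widen_ord pm y | y : 'I_p]|; last first.
  by rewrite card_imset ?card_ord // => y z [] /val_inj.
apply: eq_card => y; rewrite !inE.
apply/idP/imsetP => [yp | [z _ ->]]; last exact: ltn_ord z.
by exists (Ordinal yp) => //; exact: val_inj.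
Qed.

Lemma chain_graph_common_nbrs (m p : nat) (i j : 'I_m) : (p <= m)%N ->
  common_nbrs (fun i j : 'I_m => (i < p)%N || (j < p)%N) i j =
  if (i < p)%N && (j < p)%N then m else p.
Proof.
move=> pm; rewrite /common_nbrs; case: ifP => ijp.
  rewrite -[RHS]card_ord; apply: eq_card => y.
  by rewrite !inE; case/andP: ijp => -> ->.
rewrite -[RHS](card_ord_ltn pm); apply: eq_card => y.
by rewrite !inE -orb_andl ijp.
Qed.

(** With [a] the indicator of the first [p] rows and [q = m + 2 - p], the matrix
    is p J J^T + q a a^T, so it reduces to a 2 by 2 matrix with trace
    p^2 + 2 p q and determinant (p q)^2. *)
Lemma char_poly_chain_gram (m p : nat) : (p <= m.+2)%N ->
  'X ^+ 2 * char_poly (\matrix_(i < m.+2, j < m.+2)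
    (if (i < p)%N && (j < p)%N then m.+2 else p)%:R) =
  'X ^+ m.+2 * ('X^2 - (p%:R ^+ 2 + (p * (m.+2 - p)).*2%:R)%:P * 'X
    + ((p * (m.+2 - p))%:R ^+ 2)%:P) :> {poly R}.
Proof.
move=> pm; set q := (m.+2 - p)%N.
pose a : 'cV[R]_m.+2 := \col_i (i < p)%:R.
pose J : 'cV[R]_m.+2 := const_mx 1.
have mE : m.+2 = (p + q)%N by rewrite subnKC.
have mE' : m.+2%:R = p%:R + q%:R :> R by rewrite mE natrD.
have JJ : J^T *m J = (p + q)%:R%:M.
  apply/matrixP=> i j; rewrite !ord1 !mxE; under eq_bigr do rewrite !mxE mulr1.
  by rewrite sumr_const card_ord -mE.
have aa : \sum_(i < m.+2) (i < p)%:R = p%:R :> R.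
  rewrite -natr_sum -[in RHS](card_ord_ltn pm) -sum1dep_card.
  by congr (_%:R); rewrite [RHS]big_mkcond; apply: eq_bigr => i _; case: ifP.
have aJ : a^T *m J = p%:R%:M.
  apply/matrixP=> i j; rewrite !ord1 !mxE -aa.
  by apply: eq_bigr => k _; rewrite !mxE mulr1.
have Ja : J^T *m a = p%:R%:M.
  apply/matrixP=> i j; rewrite !ord1 !mxE -aa.
  by apply: eq_bigr => k _; rewrite !mxE mul1r.
have aa' : a^T *m a = p%:R%:M.
  apply/matrixP=> i j; rewrite !ord1 !mxE -aa.
  by apply: eq_bigr => k _; rewrite !mxE -natrM mulnb andbb.
have -> : \matrix_(i < m.+2, j < m.+2)
    (if (i < p)%N && (j < p)%N then m.+2 else p)%:R =
    0%:M + row_mx J a *m col_mx (p%:R *: J^T) (q%:R *: a^T) :> 'M[R]_m.+2.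
  rewrite raddf0 add0r mul_row_col; apply/matrixP=> i j.
  rewrite !mxE !big_ord1 !mxE.
  by case: (i < p)%N; case: (j < p)%N; rewrite /= ?mE'; ring.
have := char_poly_scalar_addM 0 (row_mx J a)
  (col_mx (p%:R *: J^T) (q%:R *: a^T)).
rewrite polyC0 subr0 comp_polyXr => ->; congr (_ * _).
rewrite mul_col_row -!scalemxAl JJ Ja aJ aa' !scale_scalar_mx char_poly_block11.
rewrite -muln2 !natrM !polyCD !polyCM !natrD.
ring.
Qed.

(** The first two singular values have product p q and sum of squares
    p^2 + 2 p q, with q = m + 2 - p; hence their sum [w] satisfies
    w^2 = p^2 + 4 p q. *)
Lemma chain_graph_spectrum (n m p : nat) (w : R) :
  n./2 = m.+2 -> (p <= m.+2)%N -> p%:R <= w ->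
  w ^+ 2 = p%:R * (4 * m.+2%:R - 3 * p%:R) ->
  let s := (w + p%:R) / 2 :: (w - p%:R) / 2 :: nseq m 0 in
  spectrum (adjmx R (chain_graph n p)) = s ++ rev [seq - x | x <- s].
Proof.
move=> nm pm pw ww s; have p0 : 0 <= p%:R :> R := ler0n _ _.
have s0 : 0 <= (w - p%:R) / 2 by lra.
rewrite /chain_graph nm; apply: (@bipartite_spectrum _ _ _ _ m.+2 id).
- by exists id.
- exact: card_ord.
- by rewrite /= path_ge_nseq // andbT; lra.
- by rewrite /= s0 all_nseq lexx orbT !andbT; lra.
rewrite (_ : \matrix_(i, j) _ = \matrix_(i < m.+2, j < m.+2)
    (if (i < p)%N && (j < p)%N then m.+2 else p)%:R); last first.
  by apply/matrixP=> i j; rewrite !mxE chain_graph_common_nbrs.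
have X0 : 'X ^+ 2 != 0 :> {poly R} by rewrite expf_neq0 ?polyX_eq0.
apply: (mulfI X0); rewrite char_poly_chain_gram // !big_cons big_nseq.
rewrite iter_mulr_1 expr0n subr0 /=.
have -> : p%:R ^+ 2 + (p * (m.+2 - p)).*2%:R =
  ((w + p%:R) / 2) ^+ 2 + ((w - p%:R) / 2) ^+ 2 :> R.
  by rewrite -muln2 !natrM natrB //; lra.
have -> : (p * (m.+2 - p))%:R = (w + p%:R) / 2 * ((w - p%:R) / 2) :> R.
  by rewrite natrM natrB //; lra.
rewrite !exprS !(rmorphXn, rmorphM, rmorphD) /=.
ring.
Qed.

End SingularValues.

(** * Comparison of the distances *)

Lemma sum_dist_nseq (R : rcfType) (m : nat) (x y : R) :
  \sum_(i < m) `|(nseq m x)`_i - (nseq m y)`_i| = `|x - y| *+ m.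
Proof.
under eq_bigr do rewrite !nth_nseq ltn_ord.
by rewrite sumr_const card_ord.
Qed.

Theorem theorem16 (R : rcfType) (u n p : nat) (P : finType)
    (D : menon_design P u) :
  (4 <= u)%N ->
  n = (8 * u ^ 2)%N ->
  p%:R = (if (3 %| u)%N then n%:R / 3 else n%:R / 3 + 1 / 3) :> R ->
  spectral_dist R (incidence_graph D) (chain_graph n p)
    > spectral_dist R (complete_bipartite n./2 n./2) (incidence_graph D).
Proof.
move=> u4 nE pE.
pose U : R := u%:R; have U4 : 4 <= U by rewrite ler_nat.
have nE' : n%:R = 8 * U ^+ 2 :> R by rewrite nE natrM natrX.
have hE : n./2 = (4 * u ^ 2)%N by rewrite nE; lia.
have [m mE] : exists m, (4 * u ^ 2)%N = m.+2.
  by exists (4 * u ^ 2 - 2)%N; nia.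
have mE' : m.+2%:R = 4 * U ^+ 2 :> R by rewrite -mE natrM natrX.
have pm : (p <= m.+2)%N.
  by rewrite -(ler_nat R) pE mE' nE'; case: ifP => _; nra.
have ww0 : (4 * U ^+ 2 + 2 * U) ^+ 2 < p%:R * (4 * m.+2%:R - 3 * p%:R).
  (* Thrice the difference of the two sides is this polynomial, minus 1 when
     p = (n + 1) / 3. *)
  have gap : 1 < U ^+ 2 * (16 * U ^+ 2 - 48 * U - 12).
    have : 1 < 16 * U ^+ 2 - 48 * U - 12 by nra.
    by have : 1 < U ^+ 2; nra.
  by rewrite pE mE' nE'; case: ifP => _; lra.
pose w := Num.sqrt (p%:R * (4 * m.+2%:R - 3 * p%:R) : R).
have wE : w ^+ 2 = p%:R * (4 * m.+2%:R - 3 * p%:R).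
  by rewrite sqr_sqrtr // (le_trans _ (ltW ww0)) ?sqr_ge0.
have w0 : 0 <= w by exact: sqrtr_ge0.
have wU : 4 * U ^+ 2 + 2 * U < w.
  by rewrite -(@ltr_pXn2r _ 2) ?nnegrE ?wE //; nra.
have pw : p%:R <= w.
  rewrite -(@ler_pXn2r _ 2) ?nnegrE ?ler0n // wE expr2 ler_wpM2l ?ler0n //.
  have : p%:R <= m.+2%:R :> R by rewrite ler_nat.
  by lra.
have sK := complete_bipartite_spectrum R m.+1.
have sB := chain_graph_spectrum (etrans hE mE) pm pw wE.
have sD : let s := (2 * u ^ 2 - u)%:R :: nseq m.+1 u%:R in
    spectrum (adjmx R (incidence_graph D)) = s ++ rev [seq - x | x <- s].
  have -> : m.+1 = (4 * u ^ 2).-1 by rewrite mE.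
  by apply: incidence_graph_spectrum; nia.
have kE : (2 * u ^ 2 - u)%:R = 2 * U ^+ 2 - U :> R.
  by rewrite natrB ?natrM ?natrX //; nia.
rewrite (etrans hE mE).
have cardK : #|complete_bipartite m.+2 m.+2| = (m.+2 + m.+2)%N.
  by rewrite card_sum card_ord.
have cardD : #|incidence_graph D| = (m.+2 + m.+2)%N.
  by rewrite card_sum card_sig (card_points D) -mE; congr (_ + _)%N; exact: card_blocks D.
rewrite (spectral_dist_symmetric cardK _ _ sK sD) /= ?size_nseq //.
rewrite (spectral_dist_symmetric cardD _ _ sD sB) /= ?size_nseq //.
rewrite ltrMn2r /= !big_ord_recl /=.
rewrite !sum_dist_nseq kE mE' sub0r normrN subr0 normr_nat -/U.
rewrite addrA [ltRHS]addrA ltrD2r.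
have k_le_m : 0 <= 4 * U ^+ 2 - (2 * U ^+ 2 - U) by nra.
rewrite (ger0_norm k_le_m) [in ltRHS]distrC [`|U - _|]distrC.
(* Whatever the signs, the two distances add up to at least w - k - u. *)
apply: lt_le_trans (lerD (ler_norm _) (ler_norm _)).
by lra.
Qed.
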